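(* Let $X$ be a nonempty set and let $N: X\times X\to \mathbb Z_+$ be a fixed function. A subset $I\subseteq \mathrm{Vert}(X,N)$ is an ideal of the vertex algebra $\mathrm{Vert}(X,N)$ if and only if $I$ is an $\mathcal A(X,N)$-submodule of $\mathrm{Vert}(X,N)$.
   Context: All linear spaces are over a field $\Bbbk$ of characteristic zero; $\mathbb Z_+$ is the set of non-negative integers. A Lie conformal algebra is a linear space $L$ with a linear operator $T:L\to L$ and bilinear $n$-products $(\cdot{}_{(n)}\cdot)$, $n\in\mathbb Z_+$, such that for all $x,y\in L$ the $\lambda$-bracket $(x{}_{(\lambda)}y)=\sum_{n\ge 0}\frac{\lambda^n}{n!}(x{}_{(n)}y)$ is a polynomial in $L[\lambda]$, and: $(Tx{}_{(\lambda)}y)=-\lambda(x{}_{(\lambda)}y)$, $(x{}_{(\lambda)}Ty)=(T+\lambda)(x{}_{(\lambda)}y)$ (sesquilinearity); $(x{}_{(\lambda)}y)+(y{}_{(-T-\lambda)}x)=0$ (skew symmetry, with $T$ acting on the coefficients from the left); $(x{}_{(\lambda)}(y{}_{(\mu)}z))-(y{}_{(\mu)}(x{}_{(\lambda)}z))=((x{}_{(\lambda)}y){}_{(\lambda+\mu)}z)$ (Jacobi). The locality function $N_L(x,y)$ is the smallest $N\in\mathbb Z_+$ with $(x{}_{(n)}y)=0$ for all $n\ge N$. A left-symmetric algebra is a linear space with a bilinear product $x.y$ such that $(x.y).z-x.(y.z)=(y.x).z-y.(x.z)$. A vertex algebra is a linear space $V$ with a linear operator $T$, a bilinear product $x.y$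 and a $\lambda$-bracket such that: (V1) $(V,.)$ is a unital left-symmetric algebra with unit $\mathbf 1$ (the vacuum) and $T$ is a derivation of it (so $T\mathbf 1=0$); (V2) $V$ with $T$ and the $\lambda$-bracket is a Lie conformal algebra; (V3) for all $x,y,z\in V$: $x.y-y.x=\int_{-T}^0(x{}_{(\lambda)}y)\,d\lambda$ (that is, $\sum_{n\ge0}(-1)^n\frac{T^{n+1}}{(n+1)!}(x{}_{(n)}y)$), and $(x{}_{(\lambda)}y.z)=(x{}_{(\lambda)}y).z+y.(x{}_{(\lambda)}z)+\int_0^\lambda((x{}_{(\lambda)}y){}_{(\mu)}z)\,d\mu$. An ideal of a vertex algebra is a $T$-invariant subspace $I$ such that $f.a$, $a.f$, $(f{}_{(s)}a)$, $(a{}_{(s)}f)$ lie in $I$ for all $a\in I$, $f\in V$, $s\in\mathbb Z_+$. $\mathcal A(X,N)$ is the associative unital algebra generated by symbols $T$ and $x(n)$ ($x\in X$, $n\in\mathbb Z$) with defining relations $\sum_{s=0}^{N(x,y)}(-1)^s\binom{N(x,y)}{s}[x(n-s),y(m+s)]=0$ ($x,y\in X$, $n,m\in\mathbb Z$) and $Tx(n)-x(n)T=-n\,x(n-1)$ ($x\in X$, $n\in\mathbb Z$). $\mathrm{Vert}(X,N)$ is the left $\mathcal A(X,N)$-module generated by one element $\mathbf 1$ with defining relations $T\mathbf 1=0$ and $x(n)\mathbf 1=0$ for $x\in X$, $n\in\mathbb Z_+$. It is known (Roitman) that $\mathrm{Vert}(X,N)$ is a vertex algebra with vacuum $\mathbf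 1$ and operator $T$, generated by the elements $x=x(-1)\mathbf 1$, $x\in X$, in which for every $a\in\mathrm{Vert}(X,N)$: $x(n)a=(x{}_{(n)}a)$ for $n\ge0$, $x(-1)a=x.a$, and $x(n)a=-\frac1{n+1}\bigl(T(x(n+1)a)-x(n+1)Ta\bigr)$ for $n\le-2$; it is the universal vertex algebra $V$ generated by $X$ with $N_V(x,y)\le N(x,y)$ for all $x,y\in X$. *)

(* Defs.v *)
From HB Require Import structures.
From mathcomp Require Import all_boot all_order all_algebra.
From mathcomp Require Import finmap.
From mathcomp Require Import boolp classical_sets functions cardinality fsbigop.
From mathcomp Require Import monalg.

Set Implicit Arguments.
Unset Strict Implicit.
Unset Printing Implicit Defensive.

Import GRing.Theory.
Local Open Scope classical_set_scope.
Local Open Scope quotient_scope.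
Local Open Scope ring_scope.

(* A polynomial in lambda with coefficients in V is given by its coefficient
   sequence; finiteness of the support is part of the axioms below. *)
Definition lpoly (V : Type) : Type := nat -> V.

Section LambdaCalculus.
Variables (k : fieldType) (V : lmodType k).
Implicit Types (T : V -> V) (p : lpoly V) (q : nat -> lpoly V).

Definition lconst (v : V) : lpoly V := fun n => if n is 0 then v else 0.

Definition lmulX p : lpoly V := fun n => if n is m.+1 then p m else 0.

(* \sum_n lambda^n q_n(lambda) *)
Definition lsumX q : lpoly V := fun m => \sum_(n < m.+1) q n (m - n)%N.

(* p(- T - lambda), with T acting on the coefficients from the left *)
Definition lsubst_NTl T p : lpoly V :=
  fun j => \sum_(n \in [set: nat])
    iter n (fun r : lpoly V => fun i => - T (r i) - lmulX r i)
      (lconst (p n)) j.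

(* p(lambda + mu); the (i, j) coefficient is that of lambda^i mu^j *)
Definition lsubst_add p : nat -> nat -> V := fun i j => p (i + j)%N *+ 'C(i + j, i).

(* \int_0^lambda p(mu) d mu *)
Definition lint p : lpoly V :=
  fun n => if n is m.+1 then m.+1%:R^-1 *: p m else 0.

(* \int_{-T}^0 p(lambda) d lambda = - \sum_n (-T)^{n+1} p_n / (n + 1) *)
Definition int_NT_0 T p : V :=
  \sum_(n \in [set: nat]) ((-1) ^+ n / n.+1%:R) *: iter n.+1 T (p n).

Definition lbracket (nprod : nat -> V -> V -> V) (x y : V) : lpoly V :=
  fun n => (n`!%:R)^-1 *: nprod n x y.

End LambdaCalculus.

Record is_lie_conformal (k : fieldType) (L : lmodType k)
    (T : {linear L -> L}) (nprod : nat -> {bilinear L -> L -> L}) : Prop := {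
  lc_local : forall x y, exists d, forall n, (d <= n)%N -> nprod n x y = 0;
  lc_sesqui_l : forall x y,
    lbracket nprod (T x) y = - lmulX (lbracket nprod x y);
  lc_sesqui_r : forall x y,
    lbracket nprod x (T y) = T \o lbracket nprod x y + lmulX (lbracket nprod x y);
  lc_skew : forall x y,
    lbracket nprod x y + lsubst_NTl T (lbracket nprod y x) = 0;
  (* coefficients of lambda^i mu^j *)
  lc_jacobi : forall x y z i j,
    lbracket nprod x (lbracket nprod y z j) i
      - lbracket nprod y (lbracket nprod x z i) j
    = lsumX (fun n i' => lsubst_add (lbracket nprod (lbracket nprod x y n) z) i' j) i
}.

Definition left_symmetric (k : fieldType) (A : lmodType k)
    (mul : {bilinear A -> A -> A}) : Prop :=
  forall x y z, mul (mul x y) z - mul x (mul y z) = mul (mul y x) z - mul y (mul x z).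

Record vertex_algebra (k : fieldType) (V : lmodType k) := VertexAlgebra {
  vvac : V;
  vT : {linear V -> V};
  vmul : {bilinear V -> V -> V};
  vnprod : nat -> {bilinear V -> V -> V};
  v_left_symmetric : left_symmetric vmul;
  v_vacl : forall x, vmul vvac x = x;
  v_vacr : forall x, vmul x vvac = x;
  v_derivation : forall x y, vT (vmul x y) = vmul (vT x) y + vmul x (vT y);
  v_lie_conformal : is_lie_conformal vT vnprod;
  v_commutator : forall x y,
    vmul x y - vmul y x = int_NT_0 vT (lbracket vnprod x y);
  (* coefficient of lambda^m *)
  v_wick : forall x y z m,
    lbracket vnprod x (vmul y z) m
    = vmul (lbracket vnprod x y m) z + vmul y (lbracket vnprod x z m)
      + lsumX (fun n => lint (lbracket vnprod (lbracket vnprod x y n) z)) m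
}.

Record vertex_ideal (k : fieldType) (V : lmodType k) (VA : vertex_algebra V)
    (I : set V) : Prop := {
  vi_subspace : submod_closed (mem I);
  vi_T : forall a, I a -> I (vT VA a);
  vi_mull : forall f a, I a -> I (vmul VA f a);
  vi_mulr : forall f a, I a -> I (vmul VA a f);
  vi_nprodl : forall s f a, I a -> I (vnprod VA s f a);
  vi_nprodr : forall s f a, I a -> I (vnprod VA s a f)
}.

Lemma malg_scalerAr (K : monomType) (R : comNzRingType) (c : R)
  (u v : {malg R[K]}) : c *: (u * v) = u * (c *: v).
Proof.
apply/malgP => m; rewrite mcoeffZ.
rewrite (mcoeffMlw m (fsubset_refl (msupp u)) (msuppZ_le c v)) mcoeffMl mulr_sumr.
apply: eq_bigr => i _; rewrite mulr_sumr; apply: eq_bigr => j _.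
by rewrite mcoeffZ mulrnAr [u@_i * (c * _)]mulrCA.
Qed.

Section FreeAlgebra.
Variables (k : fieldType) (G : Type).

(* The free associative unital algebra on G is the algebra of the free monoid. *)
Definition free_alg : Type := {malg k[{fmonom {classic G}}]}.

HB.instance Definition _ := GRing.Lalgebra.on free_alg.

Definition free_gen (g : G) : free_alg := << fmu (g : {classic G}) >>.

Lemma free_scalerAr (c : k) (u v : free_alg) : c *: (u * v) = u * (c *: v).
Proof. exact: malg_scalerAr. Qed.

HB.instance Definition _ :=
  GRing.Lalgebra_isAlgebra.Build k free_alg free_scalerAr.

End FreeAlgebra.

Definition two_sided_ideal (R : pzRingType) (J : set R) : Prop :=
  [/\ J 0, forall u v, J u -> J v -> J (u - v),
      forall a u, J u -> J (a * u) & forall a u, J u -> J (u * a)].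

Section QuotientAlgebra.
Variables (k : fieldType) (F : algType k) (S : set F).

Definition gen_ideal : set F := smallest (@two_sided_ideal F) S.

Lemma gen_ideal_two_sided : two_sided_ideal gen_ideal.
Proof.
split=> [|u v Iu Iv|a u Iu|a u Iu] J hJ; have [[J0 JB Jl Jr] _] := hJ => //.
- by apply: JB; [exact: (Iu J hJ)|exact: (Iv J hJ)].
- by apply: (Jl a u); exact: (Iu J hJ).
- by apply: (Jr a u); exact: (Iu J hJ).
Qed.

Definition gen_idealp : {pred F} := mem gen_ideal.

Lemma gen_idealP u : reflect (gen_ideal u) (u \in gen_idealp).
Proof. exact: asboolP. Qed.

Lemma gen_ideal_zmod : zmod_closed gen_idealp.
Proof.
case: gen_ideal_two_sided => I0 IB _ _; split; first exact/gen_idealP.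
by move=> u v /gen_idealP Iu /gen_idealP Iv; apply/gen_idealP; exact: (IB u v Iu Iv).
Qed.
HB.instance Definition _ := GRing.isZmodClosed.Build F gen_idealp gen_ideal_zmod.

Lemma gen_idealMl a u : u \in gen_idealp -> a * u \in gen_idealp.
Proof.
by case: gen_ideal_two_sided => _ _ Il _ /gen_idealP Iu; apply/gen_idealP; exact: (Il a u Iu).
Qed.

Lemma gen_idealMr a u : u \in gen_idealp -> u * a \in gen_idealp.
Proof.
by case: gen_ideal_two_sided => _ _ _ Ir /gen_idealP Iu; apply/gen_idealP; exact: (Ir a u Iu).
Qed.

(* F / (S), as a possibly trivial ring. *)
Definition quot_alg : Type := @Quotient.quot F gen_idealp.
HB.instance Definition _ := GRing.Zmodule.on quot_alg.

Definition quot_alg_pi (u : F) : quot_alg := \pi_(@Quotient.quot F gen_idealp) u.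
Local Notation pi := quot_alg_pi.
Let rep (a : quot_alg) : F := repr (a : @Quotient.quot F gen_idealp).

Lemma quot_alg_pi_eq u v : pi u = pi v <-> u - v \in gen_idealp.
Proof. by rewrite (Quotient.idealrBE gen_idealp u v); split=> [/eqP|/eqP]. Qed.

Let repK (a : quot_alg) : pi (rep a) = a. Proof. exact: reprK. Qed.

Lemma quot_alg_piD u v : pi (u + v) = pi u + pi v.
Proof. exact: (raddfD (\pi_(@Quotient.quot F gen_idealp))). Qed.

(* The operations are locked so that unification does not unfold them. *)
Fact quot_alg_key : unit. Proof. by []. Qed.
Definition quot_alg_mul : quot_alg -> quot_alg -> quot_alg :=
  locked_with quot_alg_key (fun a b => pi (rep a * rep b)).
Definition quot_alg_scale : k -> quot_alg -> quot_alg :=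
  locked_with quot_alg_key (fun c a => pi (c *: rep a)).

Let piM u v : pi (u * v) = quot_alg_mul (pi u) (pi v).
Proof.
rewrite /quot_alg_mul unlock; apply/quot_alg_pi_eq; set u' := rep _; set v' := rep _.
have hu : u - u' \in gen_idealp by apply/quot_alg_pi_eq; rewrite repK.
have hv : v - v' \in gen_idealp by apply/quot_alg_pi_eq; rewrite repK.
have -> : u * v - u' * v' = (u - u') * v + u' * (v - v').
  by rewrite mulrBl mulrBr addrA addrNK.
by apply: rpredD; [exact: gen_idealMr|exact: gen_idealMl].
Qed.

Let piZ c u : pi (c *: u) = quot_alg_scale c (pi u).
Proof.
rewrite /quot_alg_scale unlock; apply/quot_alg_pi_eq; rewrite -scalerBr.
rewrite -mulr_algl gen_idealMl //.
by apply/quot_alg_pi_eq; rewrite repK.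
Qed.

Lemma quot_alg_ind (P : quot_alg -> Prop) : (forall u, P (pi u)) -> forall a, P a.
Proof. by move=> h a; rewrite -(repK a). Qed.

Let mulA : associative quot_alg_mul.
Proof.
elim/quot_alg_ind=> u; elim/quot_alg_ind=> v; elim/quot_alg_ind=> w.
by rewrite -!piM mulrA.
Qed.
Let mul1 : left_id (pi 1) quot_alg_mul.
Proof. by elim/quot_alg_ind=> u; rewrite -piM mul1r. Qed.
Let mulr1 : right_id (pi 1) quot_alg_mul.
Proof. by elim/quot_alg_ind=> u; rewrite -piM mulr1. Qed.
Let mulDl : left_distributive quot_alg_mul +%R.
Proof.
elim/quot_alg_ind=> u; elim/quot_alg_ind=> v; elim/quot_alg_ind=> w.
by rewrite -quot_alg_piD -!piM -quot_alg_piD mulrDl.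
Qed.
Let mulDr : right_distributive quot_alg_mul +%R.
Proof.
elim/quot_alg_ind=> u; elim/quot_alg_ind=> v; elim/quot_alg_ind=> w.
by rewrite -quot_alg_piD -!piM -quot_alg_piD mulrDr.
Qed.
HB.instance Definition _ := GRing.Zmodule_isPzRing.Build quot_alg
  mulA mul1 mulr1 mulDl mulDr.

Let scaleA c d a :
  quot_alg_scale c (quot_alg_scale d a) = quot_alg_scale (c * d) a.
Proof. by elim/quot_alg_ind: a => u; rewrite -!piZ scalerA. Qed.
Let scale1 : left_id 1 quot_alg_scale.
Proof. by elim/quot_alg_ind=> u; rewrite -piZ scale1r. Qed.
Let scaleDr : right_distributive quot_alg_scale +%R.
Proof.
move=> c; elim/quot_alg_ind=> u; elim/quot_alg_ind=> v.
by rewrite -quot_alg_piD -!piZ -quot_alg_piD scalerDr.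
Qed.
Let scaleDl a : {morph quot_alg_scale^~ a : c d / c + d}.
Proof.
by move=> c d; elim/quot_alg_ind: a => u; rewrite -!piZ -quot_alg_piD scalerDl.
Qed.
HB.instance Definition _ := GRing.Zmodule_isLmodule.Build k quot_alg
  scaleA scale1 scaleDr scaleDl.

Lemma quot_alg_pi1 : pi 1 = 1. Proof. by []. Qed.
Lemma quot_alg_piM u v : pi (u * v) = pi u * pi v. Proof. exact: piM. Qed.
Lemma quot_alg_piZ c u : pi (c *: u) = c *: pi u. Proof. exact: piZ. Qed.

Lemma quot_alg_scaleAl (c : k) (a b : quot_alg) : c *: (a * b) = (c *: a) * b.
Proof.
elim/quot_alg_ind: a => u; elim/quot_alg_ind: b => v.
by rewrite -quot_alg_piM -!quot_alg_piZ -quot_alg_piM scalerAl.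
Qed.

Lemma quot_alg_scaleAr (c : k) (a b : quot_alg) : c *: (a * b) = a * (c *: b).
Proof.
elim/quot_alg_ind: a => u; elim/quot_alg_ind: b => v.
by rewrite -quot_alg_piM -!quot_alg_piZ -quot_alg_piM scalerAr.
Qed.

Lemma quot_alg_neq0 : ~ gen_ideal 1 -> (1 : quot_alg) != 0.
Proof.
move=> h; apply/eqP => e; apply/h/gen_idealP; rewrite -[1]subr0.
apply/quot_alg_pi_eq; rewrite quot_alg_pi1 e.
by apply: (addrI (pi 0)); rewrite -quot_alg_piD !addr0.
Qed.

End QuotientAlgebra.

Section QuotientModule.
Variables (R : nzRingType) (M : lmodType R) (S : set M).

Definition gen_submod : set M := smallest (fun J => submod_closed (mem J)) S.
Definition gen_submodp : {pred M} := mem gen_submod.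

Lemma gen_submodP u : reflect (gen_submod u) (u \in gen_submodp).
Proof. exact: asboolP. Qed.

Lemma gen_submod_closed : submod_closed gen_submodp.
Proof.
split=> [|a u v /gen_submodP Iu /gen_submodP Iv]; apply/gen_submodP => J hJ;
  have [[J0 JD] _] := hJ; apply/set_mem => //.
by apply: JD; apply/mem_set; [exact: (Iu J hJ)|exact: (Iv J hJ)].
Qed.
HB.instance Definition _ :=
  GRing.isZmodClosed.Build M gen_submodp (GRing.submod_closedB gen_submod_closed).

Definition quot_mod : Type := @Quotient.quot M gen_submodp.
HB.instance Definition _ := GRing.Zmodule.on quot_mod.

Definition quot_mod_pi (u : M) : quot_mod := \pi_(@Quotient.quot M gen_submodp) u.
Local Notation pi := quot_mod_pi.
Let rep (a : quot_mod) : M := repr (a : @Quotient.quot M gen_submodp).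

Lemma quot_mod_pi_eq u v : pi u = pi v <-> u - v \in gen_submodp.
Proof. by rewrite (Quotient.idealrBE gen_submodp u v); split=> [/eqP|/eqP]. Qed.

Let repK (a : quot_mod) : pi (rep a) = a. Proof. exact: reprK. Qed.

Lemma quot_mod_piD u v : pi (u + v) = pi u + pi v.
Proof. exact: (raddfD (\pi_(@Quotient.quot M gen_submodp))). Qed.

Definition quot_mod_scale : R -> quot_mod -> quot_mod :=
  locked_with quot_alg_key (fun c a => pi (c *: rep a)).

Let piZ c u : pi (c *: u) = quot_mod_scale c (pi u).
Proof.
rewrite /quot_mod_scale unlock; apply/quot_mod_pi_eq; rewrite -scalerBr.
have [J0 JD] := gen_submod_closed; rewrite -[_ *: _]addr0; apply: JD => //.
by apply/quot_mod_pi_eq; rewrite repK.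
Qed.

Lemma quot_mod_ind (P : quot_mod -> Prop) : (forall u, P (pi u)) -> forall a, P a.
Proof. by move=> h a; rewrite -(repK a). Qed.

Let scaleA c d a :
  quot_mod_scale c (quot_mod_scale d a) = quot_mod_scale (c * d) a.
Proof. by elim/quot_mod_ind: a => u; rewrite -!piZ scalerA. Qed.
Let scale1 : left_id 1 quot_mod_scale.
Proof. by elim/quot_mod_ind=> u; rewrite -piZ scale1r. Qed.
Let scaleDr : right_distributive quot_mod_scale +%R.
Proof.
move=> c; elim/quot_mod_ind=> u; elim/quot_mod_ind=> v.
by rewrite -quot_mod_piD -!piZ -quot_mod_piD scalerDr.
Qed.
Let scaleDl a : {morph quot_mod_scale^~ a : c d / c + d}.
Proof.
by move=> c d; elim/quot_mod_ind: a => u; rewrite -!piZ -quot_mod_piD scalerDl.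
Qed.
HB.instance Definition _ := GRing.Zmodule_isLmodule.Build R quot_mod
  scaleA scale1 scaleDr scaleDl.

Lemma quot_mod_piZ c u : pi (c *: u) = c *: pi u. Proof. exact: piZ. Qed.

End QuotientModule.

Section RestrictionOfScalars.
Variables (k : fieldType) (A : algType k) (M : lmodType A).

Definition restr_scalars : Type := M.
HB.instance Definition _ := GRing.Zmodule.on restr_scalars.

Definition restr_scale (c : k) (v : restr_scalars) : restr_scalars :=
  (c%:A : A) *: (v : M).

Let scaleA c d v : restr_scale c (restr_scale d v) = restr_scale (c * d) v.
Proof. by rewrite /restr_scale scalerA -scalerAl mul1r scalerA. Qed.
Let scale1 : left_id 1 restr_scale.
Proof. by move=> v; rewrite /restr_scale scale1r; exact: scale1r. Qed.
Let scaleDr : right_distributive restr_scale +%R.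
Proof. by move=> c u v; exact: scalerDr. Qed.
Let scaleDl v : {morph restr_scale^~ v : c d / c + d}.
Proof. by move=> c d; rewrite /restr_scale scalerDl; exact: scalerDl. Qed.
HB.instance Definition _ := GRing.Zmodule_isLmodule.Build k restr_scalars
  scaleA scale1 scaleDr scaleDl.

End RestrictionOfScalars.

Section Augmentation.
Variables (k : fieldType) (F : algType k) (C : comNzRingType).
Variable f : {rmorphism F -> C}.

Lemma rmorph_commutator u v : f (u * v - v * u) = 0.
Proof. by rewrite rmorphB !rmorphM [f v * _]mulrC subrr. Qed.

Lemma gen_ideal_proper (S : set F) : (forall r, S r -> f r = 0) -> ~ gen_ideal S 1.
Proof.
move=> hS /(_ [set u | f u = 0]) h.
suff /eqP : f 1 = 0 by rewrite rmorph1 oner_eq0.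
apply: h; split=> //=; split=> /= [|u v u0 v0|a u u0|a u u0].
- exact: rmorph0.
- by rewrite rmorphB u0 v0 subr0.
- by rewrite rmorphM u0 mulr0.
- by rewrite rmorphM u0 mul0r.
Qed.
End Augmentation.

Section Presentation.
Variables (k : fieldType) (X : Type) (N : X -> X -> nat).

Inductive symbol : Type := symT | symx of X & int.

Local Notation F := (free_alg k symbol).

Definition fT : F := free_gen k symT.
Definition fx (x : X) (n : int) : F := free_gen k (symx x n).

Definition locality_rel (x y : X) (n m : int) : F :=
  \sum_(s < (N x y).+1) ((-1) ^+ s *+ 'C(N x y, s)) *
    (fx x (n - s%:Z) * fx y (m + s%:Z) - fx y (m + s%:Z) * fx x (n - s%:Z)).

Definition derivation_rel (x : X) (n : int) : F :=
  (fT * fx x n - fx x n * fT) - (- n)%:~R * fx x (n - 1).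

Definition A_rels : set F :=
  [set r | (exists x y n m, r = locality_rel x y n m) \/
           (exists x n, r = derivation_rel x n)].

Definition A_XN : Type := quot_alg A_rels.
HB.instance Definition _ := GRing.PzRing.on A_XN.
HB.instance Definition _ := GRing.Lmodule.on A_XN.

Lemma A_XN_neq0 : (1 : A_XN) != 0.
Proof.
apply: quot_alg_neq0.
pose f : {rmorphism F -> k} := @mcoeff {fmonom {classic symbol}} k mone.
have f_gen g : f (free_gen k g) = 0.
  by rewrite /f /free_gen /= mcoeffU -fdeg_eq0 fdegU.
apply: (gen_ideal_proper (f := f)); clearbody f => r.
case=> [[x [y [n [m ->]]]]|[x [n ->]]].
  rewrite /locality_rel (raddf_sum f) big1 // => s _.
  by rewrite /= (rmorphM f) (rmorph_commutator f) mulr0.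
by rewrite /derivation_rel (rmorphB f) /= (rmorph_commutator f) (rmorphM f) f_gen mulr0 subr0.
Qed.
HB.instance Definition _ := GRing.PzSemiRing_isNonZero.Build A_XN A_XN_neq0.
HB.instance Definition _ := GRing.Lmodule_isLalgebra.Build k A_XN
  (@quot_alg_scaleAl _ _ A_rels).
HB.instance Definition _ := GRing.Lalgebra_isAlgebra.Build k A_XN
  (@quot_alg_scaleAr _ _ A_rels).

Definition aT : A_XN := quot_alg_pi A_rels fT.
Definition ax (x : X) (n : int) : A_XN := quot_alg_pi A_rels (fx x n).

(* The left module on one generator with relations r 1 = 0 (r in S) is the
   quotient of the regular module by the left ideal generated by S. *)
Definition Vert_rels : set (A_XN^o) :=
  [set r | r = aT \/ exists x (n : nat), r = ax x n%:Z].

Definition Vert : Type := quot_mod Vert_rels.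
HB.instance Definition _ := GRing.Lmodule.on Vert.

Definition Vert1 : Vert := quot_mod_pi Vert_rels 1.
Definition Vert_gen (x : X) : Vert := ax x (-1) *: Vert1.

(* Vert as a vector space over k, with the same underlying type *)
Definition Vert_space : Type := @restr_scalars k A_XN Vert.
HB.instance Definition _ := GRing.Lmodule.on Vert_space.

End Presentation.

(* Main.v *)
(** An A(X,N)-submodule is just a subspace closed under T and the x(n) with
   n >= -1: in characteristic zero the derivation relation expresses x(n-1),
   n <= -1, through x(n) and T.  Hence an ideal is a submodule.
   Conversely, for a submodule I, call f a multiplier when f.a, a.f, f_(s)a and
   a_(s)f lie in I for all a in I.  As I is a T-invariant subspace, skew symmetry
   and the commutator formula make one-sided conditions on f two-sided; with
   this freedom the Jacobi, left symmetry and Wick identities show directly that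
   x_(n)g and x.g are multipliers when x and g are.  So the multipliers form a
   submodule containing the vacuum, that is, all of Vert(X,N). *)
Require Import Defs.
From HB Require Import structures.
From mathcomp Require Import all_boot all_order all_algebra.
From mathcomp Require Import finmap.
From mathcomp Require Import boolp classical_sets.
From mathcomp Require Import monalg.

Set Implicit Arguments.
Unset Strict Implicit.
Unset Printing Implicit Defensive.

Import GRing.Theory.
Local Open Scope ring_scope.

(** * Closure rules for subspaces given as sets *)

Section Subspace.
Variables (R : pzRingType) (V : lmodType R) (I : set V).
Hypothesis hI : submod_closed (mem I).

Lemma subspace0 : I 0.
Proof. by case: hI => /set_mem. Qed.

Lemma subspaceZ c u : I u -> I (c *: u).
Proof.
case: hI => h0 h Iu; rewrite -[_ *: _]addr0; apply/set_mem/h => //.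
exact/mem_set.
Qed.

Lemma subspaceD u v : I u -> I v -> I (u + v).
Proof.
case: hI => _ h Iu Iv; rewrite -[u]scale1r; apply/set_mem/h; exact/mem_set.
Qed.

Lemma subspaceN u : I u -> I (- u).
Proof. by rewrite -scaleN1r; exact: subspaceZ. Qed.

Lemma subspaceB u v : I u -> I v -> I (u - v).
Proof. by move=> Iu Iv; apply: subspaceD => //; exact: subspaceN. Qed.

Lemma subspace_sum (J : Type) (r : seq J) (P : pred J) (F : J -> V) :
  (forall i, I (F i)) -> I (\sum_(i <- r | P i) F i).
Proof.
by move=> IF; apply: big_ind => //; [exact: subspace0|exact: subspaceD].
Qed.

Lemma subspace_subr u v : I (u - v) -> I v -> I u.
Proof. by move=> Iuv Iv; rewrite -[u](subrK v); exact: subspaceD. Qed.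

End Subspace.

(** * Multipliers of a T-invariant subspace of a vertex algebra *)

Section TwoSidedMultipliers.
Variables (k : fieldType) (V : lmodType k) (VA : vertex_algebra V).
Hypothesis hk : [pchar k] =i pred0.
Variable I : set V.
Hypothesis hI : submod_closed (mem I).
Hypothesis IT : forall a, I a -> I (vT VA a).

Local Notation T := (vT VA).
Local Notation mul := (vmul VA).
Local Notation "x _[ n ] y" := (vnprod VA n x y) (at level 40).
Local Notation lb := (lbracket (vnprod VA)).

Let fact_neq0 n : (n`!%:R : k) != 0.
Proof. by move/pcharf0P: hk => ->; rewrite -lt0n fact_gt0. Qed.

Lemma subspace_lbracket x y n : I (lb x y n) <-> I (x _[n] y).
Proof.
have nz := fact_neq0 n.
split=> [h|]; last exact: subspaceZ.
by rewrite -[_ _[_] _](scalerKV nz); apply: subspaceZ.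
Qed.

(** Skew symmetry expands each coefficient of the bracket of a and f into T-derivatives of the
    f_(n)a, so all n are needed at once. *)
Lemma subspace_nprodC f a :
  (forall s, I (f _[s] a)) -> forall s, I (a _[s] f).
Proof.
move=> Ifa s; apply/subspace_lbracket.
have /(congr1 (fun g : lpoly V => g s)) := lc_skew (v_lie_conformal VA) a f.
move=> /eqP; rewrite addr_eq0 => /eqP ->; apply: subspaceN => //.
apply: subspace_sum => // n; move: {Ifa}(Ifa n) => /subspace_lbracket.
(* The induction runs on the exponent of -T-lambda only; the index of the coefficient it acts on
   stays fixed. *)
elim: n {1 3}n s => [|m IHm] n j Ip /=; first by case: j => //= j; exact: subspace0.
apply: subspaceB => //; first by apply: subspaceN => //; apply: IT; exact: IHm.
by case: j => [|j] /=; [exact: subspace0|exact: IHm].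
Qed.

(** The integral from -T to 0 is a combination of the T^(n+1)(f_(n)a). *)
Lemma subspace_commutator f a :
  (forall s, I (f _[s] a)) -> I (mul f a - mul a f).
Proof.
move=> Ifa; rewrite v_commutator; apply: subspace_sum => // n.
apply: subspaceZ => //; have /subspace_lbracket : I (f _[n] a) by [].
by elim: n.+1 => //= m IHm Ip; apply: IT; exact: IHm.
Qed.

Definition multiplier : set V :=
  [set f | forall a, I a ->
     [/\ I (mul f a), I (mul a f) & forall s, I (f _[s] a) /\ I (a _[s] f)]].

Lemma multiplierl f :
  (forall a, I a -> I (mul f a)) -> (forall a s, I a -> I (f _[s] a)) ->
  multiplier f.
Proof.
move=> hm hn a Ia; have hs s : I (f _[s] a) by exact: hn.
split=> [||s]; first exact: hm; last by split=> //; exact: subspace_nprodC.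
rewrite -(subKr (mul f a) (mul a f)); apply: subspaceB => //; first exact: hm.
exact: subspace_commutator.
Qed.

Lemma multiplierr f :
  (forall a, I a -> I (mul a f)) -> (forall a s, I a -> I (a _[s] f)) ->
  multiplier f.
Proof.
move=> hm hn a Ia; have hs s : I (a _[s] f) by exact: hn.
split=> [||s]; [|exact: hm|by split=> //; exact: subspace_nprodC].
rewrite -(subKr (mul a f) (mul f a)); apply: subspaceB => //; first exact: hm.
exact: subspace_commutator.
Qed.

Lemma multiplier_subspace : submod_closed (mem multiplier).
Proof.
split=> [|c u v /set_mem mu /set_mem mv]; apply/mem_set.
  by apply: multiplierl => [a _|a s _]; rewrite linear0l; exact: subspace0.
apply: multiplierl => [a|a s] Ia; rewrite linearPl.
  by apply: subspaceD => //; [apply: subspaceZ => //; case: (mu a)|case: (mv a)].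
apply: subspaceD => //.
  by apply: subspaceZ => //; case: (mu a Ia) => _ _ /(_ s)[].
by case: (mv a Ia) => _ _ /(_ s)[].
Qed.

Lemma multiplier_T f : multiplier f -> multiplier (T f).
Proof.
move=> mf; apply: multiplierl => [a|a s] Ia.
  have -> : mul (T f) a = T (mul f a) - mul f (T a).
    by rewrite v_derivation addrK.
  apply: subspaceB => //; first by apply: IT; case: (mf a).
  by case: (mf (T a)) => //; exact: IT.
apply/subspace_lbracket.
have /(congr1 (fun g : lpoly V => g s)) -> :=
  lc_sesqui_l (v_lie_conformal VA) f a.
apply: subspaceN => //; case: s => [|s] /=; first exact: subspace0.
by apply/subspace_lbracket; case: (mf a Ia) => _ _ /(_ s)[].
Qed.

Lemma nprod_vacl n a : vvac VA _[n] a = 0.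
Proof.
have T1 : T (vvac VA) = 0.
  apply: (addIr (T (vvac VA))); rewrite add0r.
  by have := v_derivation VA (vvac VA) (vvac VA); rewrite v_vacl v_vacr v_vacl => <-.
(* Multiplication by lambda shifts coefficients, so the coefficient n+1 of 0 = -lambda (1_lambda a)
   isolates the n-th one. *)
have /(congr1 (fun g : lpoly V => g n.+1)) :=
  lc_sesqui_l (v_lie_conformal VA) (vvac VA) a.
rewrite T1 {1}/lbracket linear0l scaler0 => /esym/eqP.
rewrite oppr_eq0 /= /lbracket scaler_eq0 invr_eq0.
by rewrite (negbTE (fact_neq0 n)) => /eqP.
Qed.

Lemma multiplier_vac : multiplier (vvac VA).
Proof.
apply: multiplierl => [a|a s] Ia; first by rewrite v_vacl.
by rewrite nprod_vacl; exact: subspace0.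
Qed.

(** With a in I as left factor, left symmetry and the Wick formula leave only terms in which
    elements of I meet x or g. *)
Lemma multiplier_mul x g : multiplier x -> multiplier g -> multiplier (mul x g).
Proof.
move=> mx mg; apply: multiplierr => [a|a m] Ia.
  have -> : mul a (mul x g) = mul (mul a x) g - (mul (mul x a) g - mul x (mul a g)).
    by rewrite -v_left_symmetric subKr.
  have [Ixa Iax _] := mx a Ia; have [_ Iag _] := mg a Ia.
  apply: subspaceB => //; first by case: (mg (mul a x)).
  by apply: subspaceB => //; [case: (mg (mul x a))|case: (mx (mul a g))].
apply/subspace_lbracket; rewrite v_wick.
have Ilb y n : multiplier y -> I (lb a y n).
  by move=> my; apply/subspace_lbracket; case: (my a Ia) => _ _ /(_ n)[].
apply: subspaceD => //; first apply: subspaceD => //.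
- by case: (mg (lb a x m)) => //; exact: Ilb.
- by case: (mx (lb a g m)) => //; exact: Ilb.
- apply: subspace_sum => // n; case: (m - n)%N => [|i] /=; first exact: subspace0.
  apply: subspaceZ => //; apply/subspace_lbracket.
  by case: (mg (lb a x n) (Ilb _ _ mx)) => _ _ /(_ i)[].
Qed.

(** Jacobi controls brackets from the right, Wick controls products from the left; skew symmetry
    joins the two sides. *)
Lemma multiplier_nprod n x g :
  multiplier x -> multiplier g -> multiplier (x _[n] g).
Proof.
move=> mx mg.
suff : multiplier (lb x g n).
  have nz := fact_neq0 n.
  by move/(subspaceZ multiplier_subspace n`!%:R); rewrite /lbracket scalerKV.
have Inl x' a s : multiplier x' -> I a -> I (x' _[s] a).
  by move=> mx' Ia; case: (mx' a Ia) => _ _ /(_ s)[].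
have Inr x' a s : multiplier x' -> I a -> I (a _[s] x').
  by move=> mx' Ia; case: (mx' a Ia) => _ _ /(_ s)[].
(* Jacobi: a_lambda(x_mu g) = x_mu(a_lambda g) + (a_lambda x)_(lambda+mu) g, with both inner
   brackets in I. *)
have hn a i s : I a -> I (a _[s] lb x g i).
  move=> Ia; apply/subspace_lbracket.
  apply: (@subspace_subr _ _ _ hI _ (lb x (lb a g s) i)); last first.
    by apply/subspace_lbracket/Inl => //; apply/subspace_lbracket/Inr.
  rewrite (lc_jacobi (v_lie_conformal VA)).
  apply: subspace_sum => // j; rewrite /lsubst_add -scaler_nat.
  apply: subspaceZ => //; apply/subspace_lbracket/Inr => //.
  by apply/subspace_lbracket/Inr.
apply: multiplierl => [a Ia|a s Ia]; last first.
  by apply: subspace_nprodC => // s'; exact: hn.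
have Ixa m : I (lb x a m) by apply/subspace_lbracket/Inl.
have [Iga _ _] := mg a Ia.
(* The Wick formula for x and g.a, solved for the product; its integral term needs (x_(i)g)_(j)a,
   obtained from [hn]. *)
have -> : mul (lb x g n) a = lb x (mul g a) n - mul g (lb x a n)
    - lsumX (fun i => lint (lb (lb x g i) a)) n.
  by rewrite v_wick addrAC addrK addrK.
apply: subspaceB => //; first apply: subspaceB => //.
- exact/subspace_lbracket/Inl.
- by case: (mg (lb x a n)).
- apply: subspace_sum => // i; case: (n - i)%N => [|j] /=; first exact: subspace0.
  apply: subspaceZ => //; apply/subspace_lbracket.
  by apply: subspace_nprodC => // s'; exact: hn.
Qed.

End TwoSidedMultipliers.

(** * Induction on the free algebra *)

Section FreeAlgebraInduction.
Variables (k : fieldType) (G : Type).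

Lemma free_gen_mul (g : G) (m : {fmonom {classic G}}) :
  free_gen k g * << m >> = << mmul (fmu (g : {classic G})) m >> :> free_alg k G.
Proof.
rewrite /free_gen [LHS](malgMEw (msuppU_le) (msuppU_le)).
by rewrite !big_seq_fset1 !mcoeffUU mulr1.
Qed.

(** Words grow by letters on the left, which matches the action on a left module. *)
Lemma free_alg_ind (P : free_alg k G -> Prop) :
  P 1 -> (forall u v, P u -> P v -> P (u + v)) ->
  (forall c u, P u -> P (c *: u)) ->
  (forall g u, P u -> P (free_gen k g * u)) -> forall u, P u.
Proof.
move=> P1 PD PZ PM u; have P0 : P 0 by rewrite -(scale0r 1); exact: PZ.
rewrite [u]monalgE.
apply: big_ind => // m _.
have -> : << u@_m *g m >> = u@_m *: (<< m >> : free_alg k G).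
  by apply/malgP => m'; rewrite mcoeffZ !mcoeffU mulrnAr mulr1.
apply: PZ; case: m => s; elim: s => [|g s IHs]; first by rewrite -fmoneE.
have -> : FMonom (g :: s) = mmul (fmu (g : {classic G})) (FMonom s).
  by rewrite fmuE [RHS]fmmulE.
by rewrite -free_gen_mul; exact: PM.
Qed.

End FreeAlgebraInduction.

(** * Submodules of Vert(X,N) *)

Section VertSubmodules.
Variables (k : fieldType) (X : Type) (N : X -> X -> nat).
Hypothesis hk : [pchar k] =i pred0.
Local Notation V := (Vert k N).
Local Notation T := (aT k N).
Local Notation A := (A_XN k N).

Lemma derivation_relE (x : X) (n : int) :
  T * ax k N x n = (- n)%:~R *: ax k N x (n - 1) + ax k N x n * T.
Proof.
have -> : (- n)%:~R *: ax k N x (n - 1) =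
    quot_alg_pi (A_rels N) ((- n)%:~R * fx k x (n - 1)).
  by rewrite mulrzl -scaler_int quot_alg_piZ.
rewrite /aT /ax -!quot_alg_piM -quot_alg_piD.
apply/quot_alg_pi_eq/gen_idealP => J [_ /(_ (derivation_rel k x n)) RJ].
rewrite opprD addrA addrAC; apply: RJ.
by right; exists x, n.
Qed.

(** As [Negz n] is -(n+1), the derivation relation at this index has coefficient n+1, invertible in
    characteristic zero. *)
Lemma ax_Negz (x : X) (n : nat) :
  n.+1%:R *: ax k N x (Negz n.+1) = T * ax k N x (Negz n) - ax k N x (Negz n) * T.
Proof.
rewrite derivation_relE addrK.
have -> : Negz n - 1 = Negz n.+1 by rewrite !NegzE -opprD -PoszD addn1.
by rewrite [in RHS]NegzE opprK.
Qed.

(** Serves both directions: it is applied to an ideal and to the set of multipliers. *)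
Lemma Vert_submod_closed (P : set V) :
  submod_closed (mem (P : set (Vert_space k N))) ->
  (forall a, P a -> P (T *: a)) ->
  (forall x (n : nat) a, P a -> P (ax k N x n%:Z *: a)) ->
  (forall x a, P a -> P (ax k N x (-1) *: a)) ->
  submod_closed (mem P).
Proof.
move=> hP PT Px Px1.
have PZ c (a : V) : P a -> P ((c%:A : A) *: a) by exact: (subspaceZ hP).
have PD (a b : V) : P a -> P b -> P (a + b) by exact: (subspaceD hP).
have P0 : P (0 : V) by exact: (subspace0 hP).
have PN (a b : V) : P a -> P b -> P (a - b) by exact: (subspaceB hP).
(* Descent from x(-1), which is the case [Negz 0]. *)
have Pneg x (n : nat) a : P a -> P (ax k N x (Negz n) *: a).
  elim: n a => [|n IHn] a Pa; first exact: Px1.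
  have nz : ((n.+1)%:R : k) != 0 by move/pcharf0P: hk => ->.
  set c : k := n.+1%:R in nz; set v : V := ax k N x (Negz n.+1) *: a.
  have Pcv : P ((c%:A : A) *: v).
    rewrite /v scalerA mulr_algl ax_Negz scalerBl -!scalerA.
    by apply: PN; [apply/PT/IHn|apply/IHn/PT].
  have <- : (c^-1%:A : A) *: ((c%:A : A) *: v) = v.
    exact: (@scalerK k (Vert_space k N) c nz v).
  exact: PZ.
have PA (u : A) : forall a, P a -> P (u *: a).
  elim/quot_alg_ind: u; elim/free_alg_ind.
  - by move=> a Pa; rewrite quot_alg_pi1 scale1r.
  - by move=> u v Pu Pv a Pa; rewrite quot_alg_piD scalerDl; apply: PD; auto.
  - move=> c u Pu a Pa.
    have -> : quot_alg_pi (A_rels N) (c *: u) =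
        c%:A * (quot_alg_pi (A_rels N) u : A) :> A.
      by rewrite mulr_algl; exact: quot_alg_piZ.
    by rewrite -scalerA; apply: PZ; exact: Pu.
  - move=> g u Pu a /Pu; rewrite quot_alg_piM -scalerA.
    move: (_ *: a); case: g => [|x [n|n]] b Pb; [exact: PT|exact: Px|exact: Pneg].
split=> [|u a b /set_mem Pa /set_mem Pb]; apply/mem_set => //.
by apply: PD => //; exact: PA.
Qed.

(** The module is cyclic: the class of u is u acting on [Vert1]. *)
Lemma Vert_submod_full (P : set V) :
  submod_closed (mem P) -> P (Vert1 k N) -> forall a, P a.
Proof.
move=> hP P1; elim/quot_mod_ind => u.
by rewrite -[u]mulr1 -[u * 1]/(u *: (1 : A^o)) quot_mod_piZ; exact: subspaceZ.
Qed.

End VertSubmodules.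

(** * Ideals versus submodules of Vert(X,N) *)

Theorem proposition1 (k : fieldType) (hk : [pchar k] =i pred0)
    (X : Type) (hX : inhabited X) (N : X -> X -> nat)
    (VA : vertex_algebra (Vert_space k N))
    (hvac : vvac VA = Vert1 k N)
    (hT : forall a : Vert k N, vT VA a = aT k N *: a)
    (hnprod : forall (x : X) (n : nat) (a : Vert k N),
        vnprod VA n (Vert_gen k N x) a = ax k N x n%:Z *: a)
    (hmul : forall (x : X) (a : Vert k N),
        vmul VA (Vert_gen k N x) a = ax k N x (-1) *: a)
    (I : set (Vert k N)) :
  vertex_ideal VA I <-> submod_closed (mem I).
Proof.
split=> [[hI IT Iml Imr Inl Inr]|hI].
  apply: Vert_submod_closed => // [a Ia|x n a Ia|x a Ia].
  - by rewrite -hT; exact: IT.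
  - by rewrite -hnprod; exact: Inl.
  - by rewrite -hmul; exact: Iml.
(* A scalar c of the field acts as [c%:A], so a submodule is also a subspace. *)
have hIk : submod_closed (mem (I : set (Vert_space k N))).
  split=> [|c u v Iu Iv]; first by case: hI.
  by case: hI => _ /(_ (c%:A) u v Iu Iv).
have IT a : I a -> I (vT VA a) by move=> Ia; rewrite hT; exact: subspaceZ.
(* Left products with a generator are actions of x(-1) and x(n), which preserve I. *)
have gen_mult x : multiplier VA I (Vert_gen k N x).
  apply: (multiplierl hk hIk IT) => [a Ia|a s Ia].
    by rewrite hmul; exact: subspaceZ.
  by rewrite hnprod; exact: subspaceZ.
have all_mult : forall f, multiplier VA I f.
  apply: Vert_submod_full; last by rewrite -hvac; exact: multiplier_vac.
  apply: Vert_submod_closed => // [|f mf|x n f mf|x f mf].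
  - exact: multiplier_subspace.
  - by rewrite -hT; exact: multiplier_T.
  - by rewrite -hnprod; exact: multiplier_nprod.
  - by rewrite -hmul; exact: multiplier_mul.
split=> // [f a Ia|f a Ia|s f a Ia|s f a Ia]; case: (all_mult f a Ia) => //.
- by move=> _ _ /(_ s)[].
- by move=> _ _ /(_ s)[].
Qed.
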